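(* Let $\beta,\gamma>-1$. For integers $m\ge n\ge0$, $$M_{m,n}^{(\beta,\gamma)}(z_1,z_2|q)-M_{m,n}^{(\beta,\gamma)}(z_1,qz_2|q)=-\frac{q^{1-n}(1-q^n)(1-q^{m+\beta+\gamma+1})}{1-q^{m-n+\beta+1}}\,z_2\,M_{m,n-1}^{(\beta,\gamma+1)}(z_1,z_2|q).$$ For integers $m\ge n+1$, $n\ge0$, $$D_{q^{-1},z_1}\big(w(z_1z_2;q^\beta,q^\gamma|q)M_{m,n}^{(\beta,\gamma)}(z_1,z_2|q)\big)=\frac{(1-q^{m-n+\beta})\,w(z_1z_2;q^\beta,q^{\gamma-1}|q)}{q^{m-n+\beta-1}(1-q)}\,M_{m,n+1}^{(\beta,\gamma-1)}(z_1,z_2|q),$$ $$z_2^{n-m}D_{q^{-1},z_2}\big(z_2^{m-n}w(z_1z_2;q^\beta,q^\gamma|q)M_{m,n}^{(\beta,\gamma)}(z_1,z_2|q)\big)=\frac{z_1(1-q^{m-n+\beta})\,w(z_1z_2;q^\beta,q^{\gamma-1}|q)}{z_2\,q^{m-n+\beta-1}(1-q)}\,M_{m,n+1}^{(\beta,\gamma-1)}(z_1,z_2|q).$$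
   Context: $0<q<1$; $(a;q)_n=\prod_{k=0}^{n-1}(1-aq^k)$ (also for $n=\infty$), $(a,b;q)_n=(a;q)_n(b;q)_n$. $(D_{q^{-1},x}f)(x)=\frac{f(x)-f(x/q)}{(1-q^{-1})x}$, with $z_1,z_2$ treated as independent nonzero variables. $w(x;q^\alpha,q^\gamma|q)=\dfrac{(qx;q)_\infty x^\alpha}{(q^{\gamma+1}x;q)_\infty}$, with powers principal and $(z_1z_2)^\beta$ read as $z_1^\beta z_2^\beta$. The little $q$-Jacobi polynomials are $$p_n(x;q^\alpha,q^\gamma|q)=\frac{(q;q)_n}{q^{\binom n2}}\sum_{k=0}^n\frac{(q^{\alpha+\gamma+n+1};q)_{n-k}\,q^{\binom k2}(-x)^{n-k}}{(q;q)_k(q,q^{\alpha+1};q)_{n-k}}$$ (defined by this formula for $\alpha>-1$ and any real $\gamma$). $M^{(\beta,\gamma)}_{m,n}(z_1,z_2|q)=z_1^{m-n}p_n(z_1z_2;q^{\beta+m-n},q^\gamma|q)$ for $m\ge n$; terms with a negative index are $0$. *)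

(* Defs.v *)
From mathcomp Require Import all_boot all_order all_algebra.
From mathcomp Require Import all_classical all_reals all_analysis.
From mathcomp Require Export complex.
Import Order.TTheory GRing.Theory Num.Theory.
Import numFieldNormedType.Exports.

Set Implicit Arguments.
Unset Strict Implicit.
Unset Printing Implicit Defensive.

Local Open Scope ring_scope.
Local Open Scope complex_scope.
Local Open Scope classical_set_scope.

Section Definitions.
Context {R : realType}.
Implicit Types (q alpha beta gamma : R) (a x z : R[i]).

Definition qpoch a q (n : nat) : R[i] := \prod_(k < n) (1 - a * (q ^+ k)%:C).

(* R[i]^o carries the topology of the modulus on R[i]. *)
Definition qpoch_inf a q : R[i] := lim ((qpoch a q n : R[i]^o) @[n --> \oo]).

(* Principal argument, with values in ]-pi, pi] for z != 0. *)
Definition Arg z : R :=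
  let theta := acos (complex.Re z / Normc.normc z) in
  if 0 <= complex.Im z then theta else - theta.

(* Principal branch exp (alpha Log z), for z != 0. *)
Definition cpowR z alpha : R[i] :=
  (Normc.normc z `^ alpha)%:C * (cos (alpha * Arg z) +i* sin (alpha * Arg z)).

Definition qinv_derive q (f : R[i] -> R[i]) x : R[i] :=
  (f x - f (x / q%:C)) / ((1 - q^-1)%:C * x).

(* w(z1 z2; q^alpha, q^gamma | q) as a function of the two variables, since
   (z1 z2)^alpha is read as z1^alpha z2^alpha. The base powers q^alpha and
   q^gamma are given through their exponents, here and below. *)
Definition weight alpha gamma q (z1 z2 : R[i]) : R[i] :=
  qpoch_inf (q%:C * (z1 * z2)) q * (cpowR z1 alpha * cpowR z2 alpha)
  / qpoch_inf ((q `^ (gamma + 1))%:C * (z1 * z2)) q.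

(* p_n(x; q^alpha, q^gamma | q) *)
Definition little_qJacobi (n : nat) alpha gamma q x : R[i] :=
  qpoch q%:C q n / (q ^+ 'C(n, 2))%:C *
  \sum_(k < n.+1)
    qpoch (q `^ (alpha + gamma + n%:R + 1))%:C q (n - k)
    * (q ^+ 'C(k, 2))%:C * (- x) ^+ (n - k)
    / (qpoch q%:C q k
       * (qpoch q%:C q (n - k) * qpoch (q `^ (alpha + 1))%:C q (n - k))).

(* M_{m,n}^{(beta,gamma)}(z1, z2 | q), used for m >= n only; integer indices
   make the convention for negative ones expressible. *)
Definition Mpoly beta gamma (m n : int) q (z1 z2 : R[i]) : R[i] :=
  if (0 <= m) && (0 <= n) then
    z1 ^ (m - n)
    * little_qJacobi `|n|%N (beta + (m - n)%:~R) gamma q (z1 * z2)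
  else 0.

End Definitions.

(* Main.v *)
Require Import Defs.
From mathcomp Require Import all_boot all_order all_algebra.
From mathcomp Require Import all_classical all_reals all_analysis.
From mathcomp Require Import ring lra.
Import Order.TTheory GRing.Theory Num.Theory.
Import numFieldNormedType.Exports.

Local Open Scope ring_scope.
Local Open Scope complex_scope.

(** Everything rests on reading the little q-Jacobi polynomial as a terminating
    basic hypergeometric series,
      p_n(x; q^alpha, q^gamma | q)
        = 2phi1(q^-n, q^(alpha + gamma + n + 1); q^(alpha + 1); q, q x),
    obtained by reversing the defining sum ([little_qJacobi_phi]). The three
    identities then come from two facts about a series 2phi1(a, b; c; q, x)
    with generic parameters in a field.

    - [phi_qdiff]: the difference phi(x) - phi(q x) multiplies the coefficient
      of x^j by 1 - q^j, which cancels the last factor of (q; q)_j and shifts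
      the parameters to (a q, b q; c q). As M is z1^(m-n) times a function of
      x = z1 z2, this is the lowering relation in z2.

    - [phi_contiguous]: a contiguous relation between 2phi1(a q, b q; c q) at
      the points x and q x and 2phi1(a, b; c) at q x. It gives
        (1 - x) p_n(x/q; A, G) - A (1 - G x) p_n(x; A, G)
          = (1 - A) p_(n+1)(x; A/q, G/q)
      with A = q^alpha and G = q^gamma.

    The two raising relations follow from the second fact, because replacing
    z1 by z1/q changes the weight by an elementary factor. With x = z1 z2 and
    W the weight with parameter gamma - 1,
      w(x) = (1 - q^gamma x) W(x),   w(x/q) = q^-beta (1 - x) W(x),
    so w(z1 z2) M(z1, z2) - w(z1 z2/q) M(z1/q, z2) is W times the left side of
    the contiguous relation with alpha = beta + m - n, times
    - q^-alpha z1^(m-n). The relation in z2 is the one in z1 with the variables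
    exchanged, since both w and z2^(m-n) M(z1, z2) are symmetric. *)

(** * Terminating 2phi1 series over a field *)

Section BasicHypergeometric.
Context {F : fieldType}.
Implicit Types (q a b c x : F).

Definition qfac q a (n : nat) : F := \prod_(k < n) (1 - a * q ^+ k).

Lemma qfac0 q a : qfac q a 0 = 1.
Proof. exact: big_ord0. Qed.

Lemma qfacSr q a n : qfac q a n.+1 = qfac q a n * (1 - a * q ^+ n).
Proof. exact: big_ord_recr. Qed.

Lemma qfacSl q a n : qfac q a n.+1 = (1 - a) * qfac q (a * q) n.
Proof.
rewrite /qfac big_ord_recl expr0 mulr1; congr (_ * _).
by apply: eq_bigr => i _; rewrite /= /bump /= add1n exprS mulrA.
Qed.

Lemma qfac_neq0 q a n : (forall k, a * q ^+ k != 1) -> qfac q a n != 0.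
Proof.
by move=> aq1; apply/prodf_neq0 => k _; rewrite subr_eq0 eq_sym aq1.
Qed.

Definition phi_coef q a b c (j : nat) : F :=
  qfac q a j * qfac q b j / (qfac q q j * qfac q c j).

(** A partial sum of 2phi1(a, b; c; q, x). When a = q^-n it is the whole series
    as soon as N > n, so that no convergence is involved. *)
Definition phi_trunc q a b c (N : nat) x : F :=
  \sum_(j < N) phi_coef q a b c j * x ^+ j.

Lemma phi_coefSr q a b c j :
  phi_coef q a b c j.+1 = phi_coef q a b c j *
    ((1 - a * q ^+ j) * (1 - b * q ^+ j)
       / ((1 - q ^+ j.+1) * (1 - c * q ^+ j))).
Proof.
rewrite /phi_coef !qfacSr -exprS !invfM.
by ring.
Qed.

Lemma phi_coefSl q a b c j :
  phi_coef q a b c j.+1 = (1 - a) * (1 - b) / ((1 - q ^+ j.+1) * (1 - c))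
    * phi_coef q (a * q) (b * q) (c * q) j.
Proof.
rewrite /phi_coef [qfac q a _]qfacSl [qfac q b _]qfacSl [qfac q c _]qfacSl.
by rewrite qfacSr -exprS !invfM; ring.
Qed.

(** Termwise: 1 - q^(j+1) cancels against the factor that [phi_coefSl] splits
    off the coefficient of index j + 1, and the constant terms cancel. *)
Lemma phi_qdiff q a b c N x :
  (forall k, q ^+ k.+1 != 1) ->
  phi_trunc q a b c N.+1 x - phi_trunc q a b c N.+1 (q * x)
  = (1 - a) * (1 - b) / (1 - c) * x
    * phi_trunc q (a * q) (b * q) (c * q) N x.
Proof.
move=> q1; rewrite /phi_trunc -sumrB big_ord_recl !expr0 subrr add0r mulr_sumr.
apply: eq_bigr => i _; rewrite /= /bump /= add1n phi_coefSl.
have h : 1 - q ^+ i.+1 != 0 by rewrite subr_eq0 eq_sym.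
rewrite exprMn invfM; set w := (1 - q ^+ i.+1)^-1.
set u := (1 - c)^-1; set v := phi_coef _ _ _ _ _.
have e : (1 - q ^+ i.+1) * w = 1 by rewrite mulfV.
transitivity ((1 - a) * (1 - b) * u * v * x ^+ i.+1 * ((1 - q ^+ i.+1) * w)).
  ring.
by rewrite e exprS; ring.
Qed.

(** Let t_j be the coefficients of the series with parameters a q, b q, c q,
    and s = q^j. Comparing the coefficients of x^(j+1), and dividing out what
    t_j and t_(j+1) have in common, leaves the polynomial identity
      (1 - a q s) (1 - b q s) - (1 - q s) (1 - a b q s) = q s (1 - a) (1 - b).
    At x^N, where the truncated sums have no term t_N, it needs t_N = 0. *)
Lemma phi_contiguous q a b c N x :
  (forall k, q ^+ k.+1 != 1) -> (forall k, c * q ^+ k != 1) ->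
  phi_coef q (a * q) (b * q) (c * q) N = 0 ->
  (1 - x) * phi_trunc q (a * q) (b * q) (c * q) N x
  - (c - a * b * q * x) * phi_trunc q (a * q) (b * q) (c * q) N (q * x)
  = (1 - c) * phi_trunc q a b c N.+1 (q * x).
Proof.
move=> q1 cq1 tN0; set t := phi_coef q (a * q) (b * q) (c * q) in tN0 *.
(* Collect the contributions of each t_j: one to x^j, one to x^(j+1). *)
have -> : (1 - x) * phi_trunc q (a * q) (b * q) (c * q) N x
  - (c - a * b * q * x) * phi_trunc q (a * q) (b * q) (c * q) N (q * x)
  = \sum_(j < N.+1) t j * (1 - c * q ^+ j) * x ^+ j
    - \sum_(j < N) t j * (1 - a * b * q ^+ j.+1) * x ^+ j.+1.
  rewrite big_ord_recr /= -/t tN0 !mul0r addr0 /phi_trunc !mulr_sumr -!sumrB.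
  by apply: eq_bigr => j _; rewrite exprMn -/(t j) !exprS; ring.
rewrite /phi_trunc mulr_sumr !big_ord_recl -addrA -sumrB; congr (_ + _).
  by rewrite /t /phi_coef !qfac0 !expr0; ring.
apply: eq_bigr => j _; rewrite /= /bump /= add1n phi_coefSl /t phi_coefSr -/t.
have hq : 1 - q ^+ j.+1 != 0 by rewrite subr_eq0 eq_sym.
have hc : 1 - c * q * q ^+ j != 0.
  by rewrite subr_eq0 eq_sym -mulrA -exprS.
have hc0 : 1 - c != 0.
  by rewrite subr_eq0 eq_sym; have := cq1 0%N; rewrite expr0 mulr1.
rewrite -/(t j) !exprS exprMn; rewrite exprS in hq; field.
by rewrite hc0 hq hc.
Qed.

(** The reversal of a q-factorial, with n = i + j: every factor 1 - q^(n-k) of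
    (q; q)_n / (q; q)_i is - q^(n-k) (1 - q^(k-n)). The product of the q^(n-k)
    for k < j is the quotient of q^binom(n,2) by q^binom(i,2), times q^j. *)
Lemma qfac_rev q i j : q != 0 ->
  qfac q q (i + j) * q ^+ 'C(i, 2) * (- 1) ^+ j
  = qfac q (q ^- (i + j)) j * q ^+ j * q ^+ 'C(i + j, 2) * qfac q q i.
Proof.
move=> q0; elim: j i => [|j IH] i.
  by rewrite addn0 !qfac0 !expr0; ring.
have := IH i.+1; rewrite addSnnS binS bin1 exprD => e.
have q2 : q ^+ i != 0 by rewrite expf_neq0.
apply: (mulIf q2).
transitivity (qfac q q (i + j.+1) * (q ^+ 'C(i, 2) * q ^+ i) * (-1) ^+ j * -1).
  by rewrite exprS; ring.
rewrite e !qfacSr exprS.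
have -> : q ^- (i + j.+1) * q ^+ j = q ^- i.+1.
  by rewrite -addSnnS exprD invfM -mulrA mulVf ?mulr1 // expf_neq0.
by rewrite exprS; field; rewrite q2 q0.
Qed.

End BasicHypergeometric.

(** * Limits of rescaled and shifted sequences *)

Section Limits.
Local Open Scope classical_set_scope.

(** No convergence is assumed: if c is nonzero then c u_n and u_n converge or
    diverge together, and the limit of a divergent sequence is the default
    point of V, which scaling fixes when that point is 0. *)
Lemma limZ_total (K : numFieldType) (V : normedModType K) (c : K)
    (u : nat -> V) :
  point = 0 :> V ->
  lim ((c *: u n) @[n --> \oo]) = c *: lim (u n @[n --> \oo]).
Proof.
move=> V0; have [->|c0] := eqVneq c 0.
  rewrite scale0r; under eq_fun do rewrite scale0r.
  exact: (lim_cst (@norm_hausdorff _ V) (0 : V)).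
have [cu|dvg_u] := pselect (cvg (u n @[n --> \oo])).
  exact: limZl_tmp.
rewrite [in RHS]dvgP// V0 scaler0 dvgP//.
rewrite -[X in cvg X]/((c *: u) n @[n --> \oo]).
by rewrite is_cvgZlE.
Qed.

Lemma lim_shift (V : ptopologicalType) (u : nat -> V) :
  u n @[n --> \oo] = u n.+1 @[n --> \oo].
Proof.
set v := [sequence u n.+1]_n.
have uv := cvg_shiftS u (u @ \oo).
have vv := cvg_shiftS u (v @ \oo).
apply/seteqP; split.
  by change (v @ \oo --> u @ \oo); rewrite uv.
by change (u @ \oo --> v @ \oo); rewrite -vv.
Qed.

End Limits.

(** * Little q-Jacobi polynomials *)

Section LittleqJacobi.
Context {R : realType} (q : R).
Hypotheses (q_gt0 : 0 < q) (q_lt1 : q < 1).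

Let Q : R[i] := q%:C.
Let qpow (s : R) : R[i] := (q `^ s)%:C.

Lemma qpochE (a : R[i]) n : qpoch a q n = qfac Q a n.
Proof. by apply: eq_bigr => k _; rewrite rmorphXn. Qed.

Lemma qC_neq0 : Q != 0.
Proof. by rewrite fmorph_eq0 gt_eqF. Qed.

Lemma qpow_neq0 s : qpow s != 0.
Proof. by rewrite fmorph_eq0 gt_eqF// powR_gt0. Qed.

Lemma qpowD s t : qpow (s + t) = qpow s * qpow t.
Proof. by rewrite /qpow -rmorphM powRD// (gt_eqF q_gt0) implybT. Qed.

Lemma qpowN s : qpow (- s) = (qpow s)^-1.
Proof. by rewrite /qpow powRN fmorphV. Qed.

Lemma qpow_nat n : qpow n%:R = Q ^+ n.
Proof. by rewrite /qpow powR_mulrn ?ltW// rmorphXn. Qed.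

Lemma qpow1 : qpow 1 = Q.
Proof. exact: (qpow_nat 1). Qed.

Lemma qpow_neq1 s : 0 < s -> qpow s != 1.
Proof.
move=> s0; rewrite -[X in _ != X](rmorph1 (real_complex R)).
rewrite (inj_eq (fmorph_inj _)) powR_eq1 !negb_or lt_eqF//= -leNgt ltW//=.
by rewrite gt_eqF.
Qed.

Lemma qpow_shift_neq1 s k : 0 < s -> qpow s * Q ^+ k != 1.
Proof.
by move=> s0; rewrite -qpow_nat -qpowD qpow_neq1// ltr_wpDr// ler0n.
Qed.

Lemma qXS_neq1 k : Q ^+ k.+1 != 1.
Proof. by rewrite -qpow_nat qpow_neq1// ltr0n. Qed.

(** Substituting j = n - k in the defining sum puts it in increasing powers of
    x; [qfac_rev] then turns the factors depending on n - j, together with the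
    sign of (-x)^j, into (q^-n; q)_j q^j. *)
Lemma little_qJacobi_phi n alpha gamma x :
  little_qJacobi n alpha gamma q x
  = phi_trunc Q (Q ^- n) (qpow (alpha + gamma + n%:R + 1)) (qpow (alpha + 1))
      n.+1 (Q * x).
Proof.
rewrite /little_qJacobi /phi_trunc (reindex_inj rev_ord_inj) mulr_sumr.
apply: eq_bigr => -[j /= ltjn] _; rewrite subSS.
rewrite subKn // !qpochE -/Q -/(qpow _) -/(qpow _) /phi_coef.
rewrite !rmorphXn -/Q.
set b := qpow _; set c := qpow _.
have := qfac_rev Q (n - j) j qC_neq0; rewrite subnK // => e.
have qf k : qfac Q Q k != 0 by apply: qfac_neq0 => i; rewrite -exprS qXS_neq1.
have q0 k : Q ^+ k != 0 by rewrite expf_neq0 ?qC_neq0.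
rewrite exprNn exprMn.
transitivity (qfac Q Q n * Q ^+ 'C(n - j, 2) * (-1) ^+ j
  / (Q ^+ 'C(n, 2) * qfac Q Q (n - j)) * qfac Q b j * x ^+ j
  / (qfac Q Q j * qfac Q c j)).
  by rewrite !invfM; ring.
have h : qfac Q Q (n - j) * Q ^+ 'C(n, 2) != 0 by rewrite mulf_neq0.
have -> : qfac Q Q n * Q ^+ 'C(n - j, 2) * (-1) ^+ j
  / (Q ^+ 'C(n, 2) * qfac Q Q (n - j)) = qfac Q (Q ^- n) j * Q ^+ j.
  by rewrite e mulrAC -!mulrA [_^-1 * _]mulrC; field; rewrite q0 qf.
ring.
Qed.

Lemma little_qJacobi_qdiff n alpha gamma x :
  little_qJacobi n.+1 alpha gamma q x
  - little_qJacobi n.+1 alpha gamma q (Q * x)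
  = (1 - Q ^- n.+1) * (1 - qpow (alpha + gamma + n.+1%:R + 1))
    / (1 - qpow (alpha + 1)) * (Q * x)
    * little_qJacobi n (alpha + 1) (gamma + 1) q x.
Proof.
rewrite !little_qJacobi_phi; set a := Q ^- n.+1; set c := qpow (alpha + 1).
set b := qpow (alpha + gamma + n.+1%:R + 1).
have aE : Q ^- n = a * Q.
  by rewrite /a exprSr invfM divfK ?qC_neq0.
have bE : qpow (alpha + 1 + (gamma + 1) + n%:R + 1) = b * Q.
  by rewrite -qpow1 -qpowD; congr qpow; rewrite -natr1; ring.
have cE : qpow (alpha + 1 + 1) = c * Q by rewrite qpowD qpow1.
by rewrite aE bE cE phi_qdiff //; exact: qXS_neq1.
Qed.

(** [phi_contiguous] with a = q^(-n-1), b = q^(alpha + gamma + n) and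
    c = q^alpha, for which a b q = q^alpha q^gamma. *)
Lemma little_qJacobi_contiguous n alpha gamma x : 0 < alpha ->
  (1 - x) * little_qJacobi n alpha gamma q (x / Q)
  - qpow alpha * (1 - qpow gamma * x) * little_qJacobi n alpha gamma q x
  = (1 - qpow alpha) * little_qJacobi n.+1 (alpha - 1) (gamma - 1) q x.
Proof.
move=> alpha_gt0; rewrite !little_qJacobi_phi subrK.
rewrite mulrCA mulfV ?qC_neq0// mulr1.
set a := Q ^- n.+1; set b := qpow (alpha - 1 + _ + _ + 1); set c := qpow alpha.
have aE : Q ^- n = a * Q.
  by rewrite /a exprSr invfM divfK ?qC_neq0.
have bE : qpow (alpha + gamma + n%:R + 1) = b * Q.
  by rewrite -qpow1 -qpowD; congr qpow; rewrite -natr1; ring.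
have cE : qpow (alpha + 1) = c * Q by rewrite qpowD qpow1.
rewrite aE bE cE -phi_contiguous.
- congr (_ - _ * _); rewrite mulrBr mulr1 mulrA; congr (_ - _ * _).
  rewrite mulrAC -aE -qpow_nat -qpowN -!qpowD; congr qpow.
  by rewrite -natr1; ring.
- exact: qXS_neq1.
- by move=> k; apply: qpow_shift_neq1.
(* (q^-n; q)_(n+1) contains the factor 1 - q^-n q^n. *)
- rewrite /phi_coef qfacSr -aE mulVf ?expf_neq0 ?qC_neq0// subrr.
  by rewrite mulr0 !mul0r.
Qed.

(** * The weight under division of a variable by q *)

(** Peeling off the first factor of (a; q)_n+1 gives (1 - a) (a q; q)_n, and
    [limZ_total] passes to the limit; it applies because the default point of
    the complex numbers is 0. *)
Lemma qpoch_inf_rec (a : R[i]) :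
  qpoch_inf a q = (1 - a) * qpoch_inf (a * q%:C) q.
Proof.
rewrite /qpoch_inf lim_shift.
rewrite -[RHS](@limZ_total _ (R[i]^o)) //.
have -> // : (fun n => qpoch a q n.+1 : R[i]^o)
           = (fun n => (1 - a) *: (qpoch (a * q%:C) q n : R[i]^o)).
by apply/funext => n; rewrite qpochE qfacSl -qpochE.
Qed.

Lemma Arg_scale (t : R) (z : R[i]) : 0 < t -> Arg (t%:C * z) = Arg z.
Proof.
move=> t0; case: z => a b; rewrite /Arg Normc.normcM /= !mul0r subr0 addr0.
rewrite expr0n /= addr0 sqrtr_sqr gtr0_norm// pmulr_rge0//.
by rewrite -mulf_div mulfV ?gt_eqF// mul1r.
Qed.

(** A positive factor leaves the principal argument unchanged, so that it
    can be taken out of a principal power. *)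
Lemma cpowR_scale (t s : R) (z : R[i]) : 0 < t ->
  cpowR (t%:C * z) s = (t `^ s)%:C * cpowR z s.
Proof.
move=> t0; rewrite /cpowR Arg_scale// Normc.normcM /= expr0n /= addr0 sqrtr_sqr.
have z_ge0 : 0 <= Normc.normc z by case: z => a b; exact: sqrtr_ge0.
rewrite gtr0_norm// powRM ?(ltW t0)//.
by rewrite rmorphM mulrA.
Qed.

Lemma weightC beta gamma u v :
  weight beta gamma q u v = weight beta gamma q v u.
Proof. by rewrite /weight (mulrC u) (mulrC (cpowR u _)). Qed.

(** Both weights have the numerator (q u v; q)_oo; their denominators are
    (q^(gamma+1) u v; q)_oo and (q^gamma u v; q)_oo, which differ by their
    first factor. That factor has to be nonzero to be cancelled. *)
Lemma weight_gammaB beta gamma u v :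
  qpoch_inf (qpow gamma * (u * v)) q != 0 ->
  weight beta gamma q u v
  = (1 - qpow gamma * (u * v)) * weight beta (gamma - 1) q u v.
Proof.
rewrite /weight subrK -/(qpow (gamma + 1)) -/(qpow gamma) qpoch_inf_rec => h.
have -> : qpow (gamma + 1) * (u * v) = qpow gamma * (u * v) * Q.
  by rewrite qpowD qpow1 mulrAC.
move: h; rewrite mulf_eq0 negb_or => /andP[h1 h2].
by field; rewrite h1 h2.
Qed.

(** Dividing u by q turns the denominator (q^(gamma+1) u v; q)_oo into that
    of the weight with parameter gamma - 1, adds the factor 1 - u v to the
    numerator, and takes q^-beta out of the power of u. *)
Lemma weight_qdiv beta gamma u v :
  weight beta gamma q (u / Q) v
  = qpow (- beta) * (1 - u * v) * weight beta (gamma - 1) q u v.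
Proof.
rewrite /weight subrK -/(qpow (gamma + 1)) -/(qpow gamma) -/Q.
have -> : Q * (u / Q * v) = u * v by field; exact: qC_neq0.
have -> : qpow (gamma + 1) * (u / Q * v) = qpow gamma * (u * v).
  by rewrite qpowD qpow1; field; exact: qC_neq0.
have -> : cpowR (u / Q) beta = qpow (- beta) * cpowR u beta.
  rewrite mulrC -fmorphV cpowR_scale ?invr_gt0//.
  by rewrite -powR_inv1 ?ltW// -powRrM mulN1r.
rewrite qpoch_inf_rec [u * v * Q]mulrC; ring.
Qed.

(** After factoring out the weight with parameter gamma - 1, this is
    [little_qJacobi_contiguous] divided by - q^(beta + d). The factor q^-d is
    the one produced by u^d when u is divided by q. *)
Lemma weight_little_qJacobi_qdiff n d beta gamma u v : 0 < beta + d%:R ->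
  qpoch_inf (qpow gamma * (u * v)) q != 0 ->
  weight beta gamma q u v * little_qJacobi n (beta + d%:R) gamma q (u * v)
  - Q ^- d * (weight beta gamma q (u / Q) v
              * little_qJacobi n (beta + d%:R) gamma q (u / Q * v))
  = - (qpow (beta + d%:R))^-1 * (1 - qpow (beta + d%:R))
    * weight beta (gamma - 1) q u v
    * little_qJacobi n.+1 (beta + d%:R - 1) (gamma - 1) q (u * v).
Proof.
move=> alpha_gt0 nopole; rewrite weight_gammaB// weight_qdiv.
have -> : u / Q * v = u * v / Q by rewrite mulrAC.
have := little_qJacobi_contiguous n (beta + d%:R) gamma (u * v) alpha_gt0.
set W := weight _ _ _ _ _; set p2 := little_qJacobi n _ _ _ _.
set p1 := little_qJacobi n _ _ _ _; set p3 := little_qJacobi n.+1 _ _ _ _.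
set A := qpow (beta + d%:R) => contig.
have dE : Q ^- d * qpow (- beta) = A^-1.
  by rewrite -qpow_nat -!qpowN -qpowD opprD addrC.
transitivity (- A^-1 * W * ((1 - A) * p3)); last by ring.
transitivity ((1 - qpow gamma * (u * v)) * W * p1
  - (Q ^- d * qpow (- beta)) * ((1 - u * v) * W * p2)); first by ring.
by rewrite dE -contig; field; exact: qpow_neq0.
Qed.

(** * The relations for M *)

Lemma qinv_derive_weight n d beta gamma u v : 0 < beta + d.+1%:R -> u != 0 ->
  qpoch_inf (qpow gamma * (u * v)) q != 0 ->
  qinv_derive q (fun z => weight beta gamma q z v
    * (z ^+ d.+1 * little_qJacobi n (beta + d.+1%:R) gamma q (z * v))) u
  = (1 - qpow (beta + d.+1%:R)) * weight beta (gamma - 1) q u v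
    / (qpow (beta + d.+1%:R - 1) * (1 - Q))
    * (u ^+ d * little_qJacobi n.+1 (beta + d%:R) (gamma - 1) q (u * v)).
Proof.
move=> alpha_gt0 u0 nopole; rewrite /qinv_derive -/Q.
have := weight_little_qJacobi_qdiff n _ _ _ _ _ alpha_gt0 nopole.
have -> : beta + d%:R = beta + d.+1%:R - 1 by rewrite -natr1 addrA addrK.
rewrite (qpowD _ (- 1)) qpowN qpow1.
rewrite rmorphB rmorph1 fmorphV -/Q exprMn exprVn.
set W1 := weight _ gamma q u v; set W2 := weight _ _ _ _ _.
set W3 := weight _ _ _ _ _; set p1 := little_qJacobi n _ _ _ _.
set p2 := little_qJacobi n _ _ _ _; set p3 := little_qJacobi n.+1 _ _ _ _.
set A := qpow _ => e.
have A0 : A != 0 := qpow_neq0 _.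
have Q0 := qC_neq0; have Q1 : 1 - Q != 0.
  by rewrite subr_eq0 eq_sym; exact: (qXS_neq1 0).
transitivity ((W1 * p1 - Q ^- d.+1 * (W2 * p2)) * u ^+ d.+1
   / ((1 - Q^-1) * u)).
  by congr (_ / _); ring.
have Q1' : Q - 1 != 0 by rewrite -oppr_eq0 opprB.
by rewrite e exprS; field; apply/and5P; split.
Qed.

Lemma Mpoly_addn beta gamma n d u v :
  Mpoly beta gamma (n + d)%N%:Z n%:Z q u v
  = u ^+ d * little_qJacobi n (beta + d%:R) gamma q (u * v).
Proof. by rewrite /Mpoly /= PoszD addrAC subrr add0r. Qed.

Lemma Mpoly_qdiff m n beta gamma u v : (n <= m)%N ->
  Mpoly beta gamma m%:Z n%:Z q u v - Mpoly beta gamma m%:Z n%:Z q u (Q * v)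
  = - (q ^ (1 - n%:Z) * (1 - q ^+ n) * (1 - q `^ (m%:R + beta + gamma + 1))
       / (1 - q `^ (m%:R - n%:R + beta + 1)))%:C
    * v * Mpoly beta (gamma + 1) m%:Z (n%:Z - 1) q u v.
Proof.
move=> /subnKC <-; move: (m - n)%N => d {m}; rewrite !Mpoly_addn -mulrBr.
rewrite (mulrCA u Q v); case: n => [|n].
  (* p_0 is constant, and the right side vanishes by the factor 1 - q^0. *)
  rewrite !little_qJacobi_phi /phi_trunc !big_ord1 !expr0 subrr mulr0.
  by rewrite !subrr !mulr0.
have -> : n.+1%:Z - 1 = n%:Z by rewrite -addn1 PoszD addrK.
have -> : 1 - n.+1%:Z = - n%:Z by rewrite -addn1 PoszD opprD addrCA subrr addr0.
rewrite little_qJacobi_qdiff addSnnS Mpoly_addn.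
have -> : beta + d.+1%:R = beta + d%:R + 1 by rewrite -natr1 addrA.
rewrite -natr1 addrA.
have -> : (n + d.+1)%:R + beta + gamma + 1
          = beta + d%:R + gamma + (n%:R + 1) + 1 :> R.
  by rewrite natrD -natr1; ring.
have -> : (n + d.+1)%:R - (n%:R + 1) + beta + 1 = beta + d%:R + 1 :> R.
  by rewrite natrD -natr1; ring.
rewrite -exprnN rmorphM fmorphV rmorphM rmorphM fmorphV.
rewrite !rmorphB !rmorph1 !rmorphXn -/Q -!/(qpow _) addrA.
set p := little_qJacobi _ _ _ _ _; set c := (_ - qpow _)^-1.
have Qn : Q ^+ n != 0 by rewrite expf_neq0 ?qC_neq0.
transitivity (u * u ^+ d * v * p * c
  * (1 - qpow (beta + d%:R + gamma + n%:R + 1 + 1)) * ((1 - Q ^- n.+1) * Q)).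
  by rewrite /c; ring.
have -> : (1 - Q ^- n.+1) * Q = - (Q ^- n * (1 - Q ^+ n.+1)).
  by rewrite !exprS; field; rewrite Qn qC_neq0.
by rewrite [u ^+ d.+1]exprS; ring.
Qed.

Lemma qinv_derive_scale (a : R[i]) f x :
  qinv_derive q (fun z => a * f z) x = a * qinv_derive q f x.
Proof. by rewrite /qinv_derive -mulrBr mulrA. Qed.

Lemma qinv_derive_Mpoly m n beta gamma u v : -1 < beta -> (n < m)%N -> u != 0 ->
  qpoch_inf (qpow gamma * (u * v)) q != 0 ->
  qinv_derive q (fun z => weight beta gamma q z v
    * Mpoly beta gamma m%:Z n%:Z q z v) u
  = (1 - q `^ (m%:R - n%:R + beta))%:C * weight beta (gamma - 1) q u v
    / (q `^ (m%:R - n%:R + beta - 1) * (1 - q))%:C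
    * Mpoly beta (gamma - 1) m%:Z (n%:Z + 1) q u v.
Proof.
move=> beta_gt /subnKC <-; move: (m - _)%N => d {m} u0 nopole.
have -> : n%:Z + 1 = n.+1%:Z by rewrite -addn1.
rewrite Mpoly_addn addSnnS.
have -> : (n + d.+1)%:R - n%:R + beta = beta + d.+1%:R :> R.
  by rewrite natrD; ring.
under eq_fun do rewrite Mpoly_addn.
rewrite qinv_derive_weight//; last first.
  by rewrite -natr1; have := ler0n R d; lra.
by rewrite rmorphM !rmorphB rmorph1.
Qed.

(** Both sides are (u v)^(m-n) p_n(u v); this transfers relations in one
    variable to the other. *)
Lemma Mpoly_swap m n beta gamma u v : (n <= m)%N ->
  v ^+ (m - n) * Mpoly beta gamma m%:Z n%:Z q u v
  = u ^+ (m - n) * Mpoly beta gamma m%:Z n%:Z q v u.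
Proof.
move=> /subnKC <-; move: (m - n)%N => d {m}.
by rewrite !Mpoly_addn addKn mulrCA [v * u]mulrC.
Qed.

Lemma qinv_derive_Mpoly_right m n beta gamma u v : -1 < beta -> (n < m)%N ->
  v != 0 -> qpoch_inf (qpow gamma * (u * v)) q != 0 ->
  v ^ (n%:Z - m%:Z)
    * qinv_derive q (fun z => z ^ (m%:Z - n%:Z) * weight beta gamma q u z
                              * Mpoly beta gamma m%:Z n%:Z q u z) v
  = u * (1 - q `^ (m%:R - n%:R + beta))%:C * weight beta (gamma - 1) q u v
    / (v * (q `^ (m%:R - n%:R + beta - 1) * (1 - q))%:C)
    * Mpoly beta (gamma - 1) m%:Z (n%:Z + 1) q u v.
Proof.
move=> beta_gt ltnm v0 nopole; have lenm := ltnW ltnm.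
rewrite -[n%:Z - _]opprB subzn // -exprnN.
have -> : (fun z => z ^ (m - n)%N * weight beta gamma q u z
                    * Mpoly beta gamma m%:Z n%:Z q u z)
  = (fun z => u ^+ (m - n) * (weight beta gamma q z u
                    * Mpoly beta gamma m%:Z n%:Z q z u)).
  by apply/funext => z; rewrite mulrAC Mpoly_swap// weightC mulrAC mulrA.
rewrite qinv_derive_scale qinv_derive_Mpoly//; last by rewrite [v * u]mulrC.
rewrite weightC.
have -> : n%:Z + 1 = n.+1%:Z by rewrite -addn1.
have := Mpoly_swap m n.+1 beta (gamma - 1) u v ltnm.
rewrite subnS; have : (0 < m - n)%N by rewrite subn_gt0.
case: (m - n)%N => //= d _.
set M := Mpoly _ _ _ _ _ u v; set M' := Mpoly _ _ _ _ _ v u => swap.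
set X := (1 - _)%:C; set W := weight _ _ _ _ _; set K := (_ * _)%:C.
rewrite 2!exprS !invfM.
transitivity (u * X * W * K^-1 * v^-1 * (v ^- d * (u ^+ d * M'))).
  by ring.
by rewrite -swap mulKf ?expf_neq0//; ring.
Qed.

End LittleqJacobi.

Theorem theorem6p4 (R : realType) (q beta gamma : R)
    (q_gt0 : 0 < q) (q_lt1 : q < 1) (beta_gtN1 : -1 < beta)
    (gamma_gtN1 : -1 < gamma) :
  (forall (m n : nat) (z1 z2 : R[i]), (n <= m)%N ->
     Mpoly beta gamma m%:Z n%:Z q z1 z2
       - Mpoly beta gamma m%:Z n%:Z q z1 (q%:C * z2)
     = - (q ^ (1 - n%:Z) * (1 - q ^+ n) * (1 - q `^ (m%:R + beta + gamma + 1))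
          / (1 - q `^ (m%:R - n%:R + beta + 1)))%:C
       * z2 * Mpoly beta (gamma + 1) m%:Z (n%:Z - 1) q z1 z2)
  /\
  (forall (m n : nat) (z1 z2 : R[i]), (n + 1 <= m)%N ->
     z1 != 0 -> z2 != 0 ->
     (* the weights occurring below have no pole at (z1, z2) *)
     qpoch_inf ((q `^ gamma)%:C * (z1 * z2)) q != 0 ->
     qinv_derive q (fun z => weight beta gamma q z z2
                             * Mpoly beta gamma m%:Z n%:Z q z z2) z1
     = (1 - q `^ (m%:R - n%:R + beta))%:C * weight beta (gamma - 1) q z1 z2
       / (q `^ (m%:R - n%:R + beta - 1) * (1 - q))%:C
       * Mpoly beta (gamma - 1) m%:Z (n%:Z + 1) q z1 z2)
  /\
  (forall (m n : nat) (z1 z2 : R[i]), (n + 1 <= m)%N ->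
     z1 != 0 -> z2 != 0 ->
     qpoch_inf ((q `^ gamma)%:C * (z1 * z2)) q != 0 ->
     z2 ^ (n%:Z - m%:Z)
       * qinv_derive q (fun z => z ^ (m%:Z - n%:Z) * weight beta gamma q z1 z
                                 * Mpoly beta gamma m%:Z n%:Z q z1 z) z2
     = z1 * (1 - q `^ (m%:R - n%:R + beta))%:C
       * weight beta (gamma - 1) q z1 z2
       / (z2 * (q `^ (m%:R - n%:R + beta - 1) * (1 - q))%:C)
       * Mpoly beta (gamma - 1) m%:Z (n%:Z + 1) q z1 z2).
Proof.
split; [|split].
- by move=> m n z1 z2 lenm; apply: Mpoly_qdiff.
- move=> m n z1 z2; rewrite addn1 => ltnm z1_neq0 _ nopole.
  exact: qinv_derive_Mpoly.
- move=> m n z1 z2; rewrite addn1 => ltnm z1_neq0 z2_neq0 nopole.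
  exact: qinv_derive_Mpoly_right.
Qed.
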